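(* The problem Dominating-Set can be defined in $\mathrm{D}\text{-Horn}$, even without successor: there is a $\mathrm{D}\text{-Horn}$ sentence $\varphi$ over the vocabulary $\{E,P\}$ ($E$ binary, $P$ unary; no successor relation or constants) such that for every finite undirected graph $G=(V,E)$, every $k$ with $1\le k\le|V|$ and every $P\subseteq V$ with $|P|=k$: $\langle G,k\rangle\in$ Dominating-Set if and only if $(V,E\cup\{(v,v):v\in V\},P)\models\varphi$.
   Context: Dominating-Set is the set of pairs $\langle (V,E),k\rangle$ such that there is $V'\subseteq V$ with $|V'|\le k$ such that for every $v\in V\setminus V'$ there is $u\in V'$ with $(u,v)\in E$. Dependence logic uses team semantics: for a team $X$ (set of assignments with common domain), $\mathfrak A\models_X$ a literal iff all $s\in X$ satisfy it; $\mathfrak A\models_X=\!(t_1,\dots,t_n)$ iff any $s,s'\in X$ agreeing on $t_1,\dots,t_{n-1}$ agree on $t_n$; $\mathfrak A\models_X\neg=\!(\dots)$ iff $X=\emptyset$; $\wedge$ componentwise; $\vee$: $X=Y\cup Z$ with $Y$ satisfying the left and $Z$ the right disjunct; $\mathfrak A\models_X\exists x\psi$ iff $\mathfrak A\models_{\{s(F(s)/x):s\in X\}}\psi$ for some $F:X\to A$; $\mathfrak A\models_X\forall x\psi$ iff $\mathfrak A\models_{\{s(a/x):s\in X,a\in A\}}\psi$; a sentence is true iff satisfied by $\{\emptyset\}$. A clause is a disjunction of atomic and negated atomic first-order formulae (including $\bot,\top$). A $\mathrm{D}\text{-Horn}$ formula is a formula $\forall\overline x\exists y_1\dots\exists y_n(\bigwedge_{i}=\!(\overline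 z_i,y_i)\wedge\bigwedge_jC_j)$ where the $y_i$ are pairwise distinct, each $\overline z_i$ is a tuple of variables from $\overline x$, and each clause $C_j$ contains at most one positive (unnegated) atomic formula with an occurrence of an existentially quantified variable. *)

(* Defs.v *)
From mathcomp Require Import all_boot finmap.
From mathcomp Require Import boolp classical_sets.

Set Implicit Arguments.
Unset Strict Implicit.
Unset Printing Implicit Defensive.

Local Open Scope fset_scope.
Local Open Scope fmap_scope.
Local Open Scope classical_set_scope.

(** Vocabularies have relation symbols only, so that the terms over them are
    exactly the variables. *)
Record vocabulary := Vocabulary {
  symbol :> Type;
  arity : symbol -> nat
}.

Record structure (L : vocabulary) := Structure {
  carrier :> Type;
  interp : forall R : L, (arity R).-tuple carrier -> Prop
}.

Definition var := nat.

Section Syntax.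
Variable L : vocabulary.

Inductive atom :=
| Top
| Bot
| Eq of var & var
| Rel (R : L) of (arity R).-tuple var.

(** [Lit true a] is [a] and [Lit false a] is its negation; [Dep zs y] is
    =(zs, y), and [NDep zs y] is its negation. *)
Inductive formula :=
| Lit of bool & atom
| Dep of seq var & var
| NDep of seq var & var
| And of formula & formula
| Or of formula & formula
| Exists of var & formula
| Forall of var & formula.

Definition atom_vars (a : atom) : seq var :=
  match a with
  | Top | Bot => [::]
  | Eq x y => [:: x; y]
  | Rel _ ts => ts
  end.

Fixpoint free_vars (phi : formula) : {fset var} :=
  match phi with
  | Lit _ a => [fset x in atom_vars a]
  | Dep zs y | NDep zs y => [fset x in rcons zs y]
  | And phi1 phi2 | Or phi1 phi2 => (free_vars phi1 `|` free_vars phi2)%fset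
  | Exists x phi1 | Forall x phi1 => (free_vars phi1 `\ x)%fset
  end.

Definition sentence (phi : formula) : Prop := free_vars phi = fset0.

Fixpoint conj_seq (s : seq formula) : formula :=
  match s with
  | [::] => Lit true Top
  | [:: phi] => phi
  | phi :: s' => And phi (conj_seq s')
  end.

Fixpoint disj_seq (s : seq formula) : formula :=
  match s with
  | [::] => Lit true Bot
  | [:: phi] => phi
  | phi :: s' => Or phi (disj_seq s')
  end.

(** A clause is the list of its disjuncts, each given by its sign (as in
    [Lit]) and its atom. *)
Definition clause := seq (bool * atom).

Definition clause_formula (C : clause) : formula :=
  disj_seq [seq Lit l.1 l.2 | l <- C].

Definition horn_clause (ys : seq var) (C : clause) : bool :=
  count (fun l => l.1 && has (mem ys) (atom_vars l.2)) C <= 1.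

(** [deps] lists the pairs (zs_i, y_i).  The y_i are also kept apart from the
    xs: otherwise an x occurring in some zs_i could be captured by the
    existential quantifier of a y_j. *)
Definition D_Horn (phi : formula) : Prop :=
  exists (xs : seq var) (deps : seq (seq var * var)) (Cs : seq clause),
    let ys := [seq d.2 | d <- deps] in
    [/\ uniq ys,
        ~~ has (mem xs) ys,
        (forall d, d \in deps -> {subset d.1 <= xs}),
        all (horn_clause ys) Cs
      & phi = foldr Forall
                (foldr Exists
                   (conj_seq ([seq Dep d.1 d.2 | d <- deps]
                              ++ [seq clause_formula C | C <- Cs]))
                   ys)
                xs].

End Syntax.

Arguments Top {L}.
Arguments Bot {L}.
Arguments Eq {L}.
Arguments Rel {L}.
Arguments Lit {L}.
Arguments Dep {L}.
Arguments NDep {L}.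
Arguments And {L}.
Arguments Or {L}.
Arguments Exists {L}.
Arguments Forall {L}.

Section TeamSemantics.
Variables (L : vocabulary) (M : structure L).

Definition assignment := {fmap var -> M}.

(** Only meaningful when the variables of [a] are in the domain of [s], which
    is always the case when evaluating a sentence on the team {empty}. *)
Definition atom_holds (s : assignment) (a : atom L) : Prop :=
  match a with
  | Top => True
  | Bot => False
  | Eq x y => exists v : M, s.[? x] = Some v /\ s.[? y] = Some v
  | Rel R ts => exists vs : (arity R).-tuple M,
      [seq s.[? x] | x <- ts] = [seq Some v | v <- vs] /\ interp vs
  end.

Fixpoint sat (X : set assignment) (phi : formula L) : Prop :=
  match phi with
  | Lit true a => forall s, X s -> atom_holds s a
  | Lit false a => forall s, X s -> ~ atom_holds s a
  | Dep zs y => forall s s', X s -> X s' ->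
      (forall z, z \in zs -> s.[? z] = s'.[? z]) -> s.[? y] = s'.[? y]
  | NDep _ _ => X = set0
  | And phi1 phi2 => sat X phi1 /\ sat X phi2
  | Or phi1 phi2 => exists Y Z : set assignment,
      [/\ X = Y `|` Z, sat Y phi1 & sat Z phi2]
  | Exists x phi1 => exists F : X -> M,
      sat (range (fun s : X => (val s).[x <- F s])) phi1
  | Forall x phi1 => sat [set s.[x <- a] | s in X & a in [set: M]] phi1
  end.

Definition models (phi : formula L) : Prop := sat [set [fmap]] phi.

End TeamSemantics.

Inductive EP_symbol := symE | symP.

Definition EP_vocabulary : vocabulary :=
  Vocabulary (fun R => match R with symE => 2 | symP => 1 end).

Definition EP_structure (V : Type) (E : V -> V -> Prop) (P : V -> Prop) :
    structure EP_vocabulary :=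
  @Structure EP_vocabulary V (fun R =>
    match R return (@arity EP_vocabulary R).-tuple V -> Prop with
    | symE => fun t => E (tnth t ord0) (tnth t ord_max)
    | symP => fun t => P (tnth t ord0)
    end).

Definition Dominating_Set (V : finType) (E : rel V) (k : nat) : Prop :=
  exists V' : {set V}, #|V'| <= k /\
    forall v, v \notin V' -> exists2 u, u \in V' & E u v.

(* Main.v *)
Require Import Defs.
From mathcomp Require Import all_boot finmap.
From mathcomp Require Import boolp classical_sets.

(** The sentence is
      forall x0 x1 exists x2 x3
        (=(x0, x2) /\ =(x1, x3) /\ P(x3) /\ (~ x0 = x3 \/ E(x2, x1))).
    Its Skolem functions are f, with x2 = f(x0), and g, with x3 = g(x1).
    The image of P under f is the candidate dominating set, of size at most
    |P| = k, and g(v) is a point of P such that f(g(v)) dominates v.  The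
    composition f(g(x1)) is expressed by guarding E(x2, x1) with the negative
    atom ~ x0 = x3, so each clause keeps a single positive atom. *)

Local Open Scope fmap_scope.
Local Open Scope classical_set_scope.

Definition ds_deps : seq (seq var * var) := [:: ([:: 0], 2); ([:: 1], 3)].

Definition ds_clauses : seq (clause EP_vocabulary) :=
  [:: [:: (true, @Rel EP_vocabulary symP [tuple 3])];
      [:: (false, Eq 0 3); (true, @Rel EP_vocabulary symE [tuple 2; 1])]].

Definition ds_matrix : formula EP_vocabulary :=
  conj_seq ([seq Dep d.1 d.2 | d <- ds_deps]
            ++ [seq clause_formula C | C <- ds_clauses]).

Definition ds_formula : formula EP_vocabulary :=
  Forall 0 (Forall 1 (Exists 2 (Exists 3 ds_matrix))).

Lemma ds_formula_D_Horn : D_Horn ds_formula.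
Proof.
exists [:: 0; 1], ds_deps, ds_clauses; split=> // d.
by rewrite !inE => /orP[] /eqP-> z; rewrite !inE => /eqP->.
Qed.

Lemma ds_formula_sentence : sentence ds_formula.
Proof.
apply/fsetP=> x; rewrite /ds_formula /ds_matrix /= !inE.
by case: x => [|[|[|[|x]]]].
Qed.

Section Assignments.
Context {L : vocabulary} {M : structure L}.

Definition asg2 (a b : M) : assignment M := [fmap].[0 <- a].[1 <- b].

Definition asg4 (a b c d : M) : assignment M := (asg2 a b).[2 <- c].[3 <- d].

Lemma asg2E a b :
  ((asg2 a b).[? 0] = Some a) * ((asg2 a b).[? 1] = Some b).
Proof. by rewrite /asg2 !fnd_set. Qed.

Lemma asg4E a b c d :
  ((asg4 a b c d).[? 0] = Some a) * ((asg4 a b c d).[? 1] = Some b) *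
  ((asg4 a b c d).[? 2] = Some c) * ((asg4 a b c d).[? 3] = Some d).
Proof. by rewrite /asg4 /asg2 !fnd_set. Qed.

(** The builder [asg] is a parameter so that concrete finite maps can later be abstracted to their
    lookups. *)
Definition skolem_team (asg : M -> M -> M -> M -> assignment M)
    (f g : M -> M -> M) : set (assignment M) :=
  [set s | exists a b, s = asg a b (f a b) (g a b)].

(** Trades a choice function on the subtype of [X] for a total one on assignments, [v0] being the
    junk value outside [X]. *)
Lemma sat_Exists (v0 : M) (X : set (assignment M)) x (psi : formula L) :
  sat X (Exists x psi) <->
  exists F : assignment M -> M, sat [set s.[x <- F s] | s in X] psi.
Proof.
split=> [[F satF] | [F satF]].
- pose F' s := if insub s is Some u then F u else v0.
  have F'E (u : X) : F' (val u) = F u by rewrite /F' valK.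
  exists F'; congr (sat _ psi): satF.
  apply/seteqP; split=> [_ [u _ <-] | _ [s Xs <-]].
  + by exists (val u); rewrite ?F'E //; apply: set_mem (valP u).
  + by exists (SigSub (mem_set Xs)); rewrite // -F'E.
- exists (fun s => F (val s)); congr (sat _ psi): satF; apply/seteqP.
  split=> [_ [s Xs <-] | _ [u _ <-]].
  + by exists (SigSub (mem_set Xs)).
  + by exists (val u) => //; apply: set_mem (valP u).
Qed.

(** After the universal quantifiers a team member is determined by its values at [0] and [1], so
    each existential choice amounts to a binary function on [M]. The second choice sees the value at
    [2] as well, but that value is already a function of the first two. *)
Lemma models_skolem (v0 : M) (psi : formula L) :
  models M (Forall 0 (Forall 1 (Exists 2 (Exists 3 psi)))) <->
  exists f g, sat (skolem_team asg4 f g) psi.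
Proof.
rewrite /models /=; set X := image2 _ _ _.
rewrite -/(sat X (Exists 2 (Exists 3 psi))).
have Xasg2 a b : X (asg2 a b).
  by exists ([fmap].[0 <- a]); [exists [fmap] => //; exists a | exists b].
have XE s : X s -> exists a b, s = asg2 a b.
  by move=> [_ [_ -> [a _ <-]] [b _ <-]]; exists a, b.
split=> [/(sat_Exists v0)[F /(sat_Exists v0)[G sFG]] | [f [g sfg]]].
- exists (fun a b => F (asg2 a b)),
    (fun a b => G (asg2 a b).[2 <- F (asg2 a b)]).
  congr (sat _ psi): sFG; apply/seteqP.
  split=> [_ [_ [s /XE[a [b ->]] <-] <-] | _ [a [b ->]]].
  + by exists a, b.
  + by exists (asg2 a b).[2 <- F (asg2 a b)] => //; exists (asg2 a b).
(* The default [v0] is never reached on the team, where [0] and [1] are always assigned. *)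
- pose lift h (s : assignment M) := h (odflt v0 s.[? 0]) (odflt v0 s.[? 1]) : M.
  apply/(sat_Exists v0); exists (lift f).
  apply/(sat_Exists v0); exists (lift g).
  congr (sat _ psi): sfg; apply/seteqP.
  split=> [_ [a [b ->]] | _ [_ [s /XE[a [b ->]] <-] <-]].
  + exists (asg2 a b).[2 <- f a b].
      by exists (asg2 a b); rewrite // /lift !asg2E.
    by rewrite /lift !fnd_set.
  + by exists a, b; rewrite /lift !fnd_set.
Qed.

End Assignments.

(** The two dependence atoms reduce the binary Skolem functions to unary ones; the guarded clause
    matters exactly where the value at [0] is [g v]. *)
Lemma models_ds_formula (M : structure EP_vocabulary) (v0 : M) :
  let P v := @interp _ M symP [tuple v] in
  let E u v := @interp _ M symE [tuple u; v] in
  models M ds_formula <->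
  exists f g : M -> M, forall v, P (g v) /\ E (f (g v)) v.
Proof.
move=> P E.
have holdsP (s : assignment M) x a : s.[? x] = Some a ->
    atom_holds s (@Rel EP_vocabulary symP [tuple x]) <-> P a.
  move=> sx; split=> [[vs [vsE Pvs]] | Pa].
    suff vsa : vs = [tuple a] by rewrite vsa in Pvs.
    by apply/val_inj/(inj_map Some_inj); rewrite -vsE /= sx.
  by exists [tuple a]; split; rewrite //= sx.
have holdsE (s : assignment M) x y a b : s.[? x] = Some a -> s.[? y] = Some b ->
    atom_holds s (@Rel EP_vocabulary symE [tuple x; y]) <-> E a b.
  move=> sx sy; split=> [[vs [vsE Evs]] | Eab].
    suff vsab : vs = [tuple a; b] by rewrite vsab in Evs.
    by apply/val_inj/(inj_map Some_inj); rewrite -vsE /= sx sy.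
  by exists [tuple a; b]; split; rewrite //= sx sy.
rewrite (models_skolem v0).
(* Keeps unification from unfolding the lookups in the concrete assignments. *)
move: (@asg4 _ M) (@asg4E _ M) => asg asgE; split=>
  [[f [g [depf [depg [satP]]]]] | [f [g fgP]]].
- move=> [Y [Z [YZ satY satZ]]].
  have {}satZ s : Z s -> atom_holds s (@Rel EP_vocabulary symE [tuple 2; 1]).
    exact: satZ.
  have inX a b : skolem_team asg f g (asg a b (f a b) (g a b)) by exists a, b.
  (* Each function ignores one argument, which can thus be frozen at [v0]. *)
  have fE a b : f a b = f a v0.
    have := depf _ _ (inX a b) (inX a v0); rewrite !asgE => /(_ _)/Some_inj; apply.
    by move=> z; rewrite inE => /eqP->; rewrite !asgE.
  have gE a b : g a b = g v0 b.
    have := depg _ _ (inX a b) (inX v0 b); rewrite !asgE => /(_ _)/Some_inj; apply.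
    by move=> z; rewrite inE => /eqP->; rewrite !asgE.
  exists (f^~ v0), (g v0) => v; split.
    by apply/holdsP/(satP _ (inX v0 v)); rewrite asgE.
  (* Giving [0] the value [g v0 v] makes the guard true, so this assignment cannot lie in [Y] and
     must satisfy the edge atom. *)
  have := inX (g v0 v) v; rewrite YZ => -[/satY[] | /satZ Efgv].
    by exists (g v0 v); rewrite !asgE gE.
  by move: Efgv; rewrite (holdsE _ _ _ (f (g v0 v) v) v) ?asgE // fE.
- exists (fun a _ => f a), (fun _ b => g b); split.
    move=> _ _ [a [b ->]] [a' [b' ->]] /(_ 0); rewrite !asgE.
    by move=> /(_ (mem_head _ _))[->].
  split.
    move=> _ _ [a [b ->]] [a' [b' ->]] /(_ 1); rewrite !asgE.
    by move=> /(_ (mem_head _ _))[->].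
  split.
    by move=> _ [a [b ->]]; apply/holdsP; [rewrite asgE | case: (fgP b)].
  set X := skolem_team _ _ _.
  pose guard (s : assignment M) := atom_holds s (Eq 0 3).
  (* The disjunction is witnessed by splitting the team according to the guard. *)
  exists (X `&` ~` guard), (X `&` guard); split.
  + by rewrite -setIUr setUC setUv setIT.
  + by move=> s [].
  + move=> _ [[a [b ->]] [c]]; rewrite !asgE => -[[<-] [ga]].
    apply/(holdsE _ _ _ (f a) b); rewrite ?asgE // -ga.
    by case: (fgP b).
Qed.

(** Matches the enumerations of [A] and [B] position by position; surplus elements go to [b0], which
    is why [B] must be nonempty. *)
Lemma card_le_image (T T' : finType) (A : {set T}) (B : {set T'}) :
  0 < #|B| <= #|A| -> exists f : T -> T', [set f x | x in A]%SET = B.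
Proof.
case/andP=> /card_gt0P[b0 Bb0] leBA.
exists (fun x => nth b0 (enum B) (index x (enum A))).
apply/setP=> b; apply/imsetP/idP=> [[x Ax ->] | Bb].
  have [lt_iB | le_Bi] := ltnP (index x (enum A)) (size (enum B)).
    by rewrite -mem_enum mem_nth.
  by rewrite nth_default.
have iA : index b (enum B) < size (enum A).
  by rewrite -cardE (leq_trans _ leBA) // cardE index_mem mem_enum.
have [a0 _] : exists a, a \in A.
  by apply/card_gt0P; apply: leq_trans leBA; apply/card_gt0P; exists b.
exists (nth a0 (enum A) (index b (enum B))).
  by rewrite -mem_enum mem_nth.
by rewrite index_uniq ?enum_uniq // nth_index ?mem_enum.
Qed.

Theorem theorem4p5 :
  exists phi : formula EP_vocabulary,
    [/\ D_Horn phi,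
        sentence phi
      & forall (V : finType) (E : rel V) (k : nat) (P : {set V}),
          symmetric E -> 1 <= k <= #|V| -> #|P| = k ->
          (Dominating_Set E k <->
           models (EP_structure (fun u v => E u v \/ u = v)
                                (fun v => v \in P))
                  phi)].
Proof.
exists ds_formula; split; [exact: ds_formula_D_Horn | exact: ds_formula_sentence |].
move=> V E k P _ /andP[k_gt0 _] cardP.
have /card_gt0P[v0 _] : 0 < #|P| by rewrite cardP.
rewrite (@models_ds_formula (EP_structure _ _) v0);
  split=> [[D [leDk domD]] | [f [g fgP]]].
(* The added loops let members of [D] dominate themselves, so domination holds at every vertex. *)
- have dom v : exists2 u, u \in D & E u v \/ u = v.
    have [Dv | /domD[u Du Euv]] := boolP (v \in D); first by exists v; [|right].
    by exists u; [|left].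
  have D_gt0 : 0 < #|D| by apply/card_gt0P; have [u] := dom v0; exists u.
  have /card_le_image[f fP] : 0 < #|D| <= #|P| by rewrite D_gt0 cardP.
  have /choice[g gP] v : exists p, p \in P /\ (E (f p) v \/ f p = v).
    by have [u + uv] := dom v; rewrite -fP => /imsetP[p Pp uE]; exists p; rewrite -uE.
  by exists f, g.
- exists [set f p | p in P]%SET; split; first by rewrite -cardP leq_imset_card.
  move=> v vNfP; have [Pg [/= Efv | /= fv]] := fgP v; have fP := imset_f f Pg.
    by exists (f (g v)).
  (* A loop would make [v] equal to [f (g v)], a member of the image. *)
  by case/negP: vNfP; rewrite -[v]fv.
Qed.
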